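(* For arbitrary nonzero integers $r,s,t,v,w$ such that $rst=vw$ and $r^2s+w^2+rst=(r+t)(v+w)$, we have $$\frac{r+t+v+w}{rst}\in R^{(3)}_{\mathbb Q}.$$
   Context: For an integer sequence $\mathbf n=(n_1,n_2,\dots)$: $s^{\mathbf n}_0(t)=0$, $s^{\mathbf n}_1(t)=1$, $s^{\mathbf n}_{j+1}(t)=n_j\,t\,s^{\mathbf n}_j(t)-s^{\mathbf n}_{j-1}(t)$. For $l\ge 0$, $R^{(l)}$ is the set of $q\in\mathbb C$ such that $s^{\mathbf n}_{2m+2}(\sqrt{-q})=0$ for some integer $m\in[0,l]$ and some sequence $\mathbf n=(n_1,\dots,n_{2m+1})$ of nonzero integers (the choice of square root is irrelevant); note $0\in R^{(l)}$. $R^{(l)}_{\mathbb Q}=R^{(l)}\cap\mathbb Q$. *)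

(* Defs.v *)
From HB Require Import structures.
From mathcomp Require Import all_boot all_order all_algebra.
From mathcomp Require Import classical_sets reals.
From mathcomp Require Import complex.

Set Implicit Arguments.
Unset Strict Implicit.
Unset Printing Implicit Defensive.

Import Order.TTheory GRing.Theory Num.Theory.

Local Open Scope classical_set_scope.
Local Open Scope complex_scope.
Local Open Scope ring_scope.

(* s^n_j(t), with sequences indexed from 1, as in (n_1, n_2, ...): [n 0] is
   never used, and s^n_j depends only on n_1, ..., n_(j-1). *)
Fixpoint s_val (A : comNzRingType) (n : nat -> int) (j : nat) (t : A) : A :=
  match j with
  | 0 => 0
  | j1.+1 =>
    match j1 with
    | 0 => 1
    | j2.+1 => (n j1)%:~R * t * s_val n j1 t - s_val n j2 t
    end
  end.

(* R^(l).  A finite sequence (n_1, ..., n_(2m+1)) is given as the restriction of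
   [n] to the indices 1, ..., 2m+1: the other values are unconstrained and do
   not enter s^n_(2m+2). *)
Definition Rset (R : realType) (l : nat) : set R[i] :=
  [set q : R[i] | exists m : nat, exists n : nat -> int,
    [/\ (m <= l)%N,
        (forall j : nat, (1 <= j <= m.*2.+1)%N -> n j != 0) &
        s_val n m.*2.+2 (sqrtC (- q)) = 0]].

Definition rationals (R : realType) : set R[i] :=
  [set q : R[i] | exists p : rat, q = ratr p].

Definition RsetQ (R : realType) (l : nat) : set R[i] :=
  @Rset R l `&` @rationals R.
Arguments Rset : clear implicits.
Arguments RsetQ : clear implicits.
Arguments rationals : clear implicits.

(* Main.v *)
(** A zero is given by the sequence [(r, -s, t, -1, v, -1, w)].  Up to the
    factor [- sqrt (- q)], [s_8] is a cubic polynomial in [q] whose constant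
    term is [N = r + t + v + w].  With [D = rst], the two relations turn its
    coefficients of [q], [q^2], [q^3] into [- (rs + w) N - D],
    [D (N + w + rs)] and [- D^2], so that it factors as
    [(N - q D) (1 - (rs + w) q + D q^2)], which vanishes at [q = N / D]. *)

Require Import Defs.
From mathcomp Require Import all_boot all_order all_algebra.
From mathcomp Require Import classical_sets reals.
From mathcomp Require Import complex.
From mathcomp Require Import ring.

Import Order.TTheory GRing.Theory Num.Theory.

Local Open Scope classical_set_scope.
Local Open Scope complex_scope.
Local Open Scope ring_scope.

(** The leading [0] is padding: sequences are indexed from 1. *)
Definition zero_seq (r s t v w : int) (j : nat) : int :=
  nth 0 [:: 0; r; - s; t; -1; v; -1; w] j.

(** [hx] is [q = N / D] for [q = - x ^+ 2] with the denominator cleared, so that only ring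
    identities are involved. *)
Lemma s_val_zero_seq (A : comNzRingType) (r s t v w : int) (x : A)
    (h1 : r * s * t = v * w)
    (h2 : r ^+ 2 * s + w ^+ 2 + r * s * t = (r + t) * (v + w))
    (hx : (r + t + v + w)%:~R = - x ^+ 2 * (r * s * t)%:~R) :
  s_val (zero_seq r s t v w) 8 x = 0.
Proof.
have := congr1 (fun k : int => k%:~R : A) h2.
have := congr1 (fun k : int => k%:~R : A) h1; move: hx.
rewrite /= /zero_seq /= ?(rmorphD, rmorphM, rmorphXn, rmorphN, rmorph1) /=.
move: (r%:~R : A) (s%:~R : A) (t%:~R : A) (v%:~R : A) (w%:~R : A).
move=> {h1 h2}{}r {}s {}t {}v {}w.
set q := - x ^+ 2; set D := r * s * t; set N := r + t + v + w.
move=> /eqP; rewrite -subr_eq0 => /eqP g0.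
move=> /eqP; rewrite -subr_eq0 => /eqP e0.
move=> /eqP; rewrite -subr_eq0 => /eqP f0.
(* This holds with no hypothesis: the defect of the second relation corrects the coefficient of [q],
   that of the first those of [q ^+ 2] and [q ^+ 3]. *)
transitivity (- x * ((N - q * D) * (1 - (r * s + w) * q + D * q ^+ 2)
    + q * (r ^+ 2 * s + w ^+ 2 + D - (r + t) * (v + w))
    + (D - v * w) * (q ^+ 3 * D - q ^+ 2 * (r * s + r + t)))).
  by rewrite /q /D /N; ring.
by rewrite g0 e0 f0; ring.
Qed.

Theorem proposition4p6 (R : realType) (r s t v w : int)
  (hr : r != 0) (hs : s != 0) (ht : t != 0) (hv : v != 0) (hw : w != 0)
  (h1 : r * s * t = v * w)
  (h2 : r ^+ 2 * s + w ^+ 2 + r * s * t = (r + t) * (v + w)) :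
  RsetQ R 3 ((r + t + v + w)%:~R / (r * s * t)%:~R : R[i]).
Proof.
split; last first.
  exists ((r + t + v + w)%:~R / (r * s * t)%:~R).
  by rewrite fmorph_div !rmorph_int.
exists 3, (zero_seq r s t v w); split=> //.
  by do 8?[case=> //]; move=> _; rewrite /zero_seq /= ?oppr_eq0.
apply: s_val_zero_seq => //.
(* The square of the root is [- q], so [hx] becomes [N = N / D * D]. *)
by rewrite sqrtCK opprK divfK // intr_eq0 !mulf_neq0.
Qed.
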